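(* Let $R$ be a commutative ring with unity, let $\Gamma$ be an $R$-local group and $A$ a Cohn local module over $R\Gamma$. Then for any group extension $0\to A\to\tilde\Gamma\to\Gamma\to1$ (with the $\Gamma$-action on $A$ induced by conjugation being the given module structure), the group $\tilde\Gamma$ is $R$-local.
   Context: A homomorphism $\alpha\colon\pi\to G$ is $R$-homology 2-connected if it induces an isomorphism on $H_1(-;R)$ and a surjection on $H_2(-;R)$; $\Omega^R$ is the class of such $\alpha$ with $\pi,G$ finitely presented. A group $K$ is $R$-local if for every $\alpha\colon\pi\to G$ in $\Omega^R$ and every $f\colon\pi\to K$ there is a unique $g\colon G\to K$ with $g\alpha=f$. An $RG$-module $A$ is a Cohn local module if for every homomorphism $\alpha\colon F_0\to F_1$ of finitely generated free $RG$-modules of the same rank such that $1_R\otimes\alpha\colon R\otimes_{RG}F_0\to R\otimes_{RG}F_1$ is an isomorphism, and every homomorphism $f\colon F_0\to A$, there is a unique homomorphism $g\colon F_1\to A$ with $f=g\alpha$. *)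

(* Defs.v *)
From Stdlib Require Import ClassicalDescription.
From mathcomp Require Import all_boot all_algebra.
Set Implicit Arguments. Unset Strict Implicit. Unset Printing Implicit Defensive.
Import GRing.Theory.
Local Open Scope ring_scope.

Record grp := Grp {
  gcar :> Type;
  gmul : gcar -> gcar -> gcar;
  gone : gcar;
  ginv : gcar -> gcar;
  gmulA : forall x y z, gmul x (gmul y z) = gmul (gmul x y) z;
  gmul1 : forall x, gmul gone x = x;
  gmulV : forall x, gmul (ginv x) x = gone }.

Definition is_hom (G H : grp) (f : G -> H) : Prop :=
  forall x y, f (gmul x y) = gmul (f x) (f y).

Definition word_eval (n : nat) (H : grp) (h : 'I_n -> H)
    (w : seq ('I_n * bool)) : H :=
  foldr (fun p acc => gmul (if p.2 then ginv (h p.1) else h p.1) acc) (gone H) w.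

Definition presentation (P : grp) (n : nat) (gen : 'I_n -> P)
    (rels : seq (seq ('I_n * bool))) : Prop :=
  (forall r, r \in rels -> word_eval gen r = gone P) /\
  forall (H : grp) (h : 'I_n -> H),
    (forall r, r \in rels -> word_eval h r = gone H) ->
    exists phi : P -> H, [/\ is_hom phi, (forall i, phi (gen i) = h i) &
      forall psi : P -> H, is_hom psi -> (forall i, psi (gen i) = h i) ->
        forall x, psi x = phi x].

Definition fin_presented (P : grp) : Prop :=
  exists n gen rels, @presentation P n gen rels.

Section Homology.
Variable R : comPzRingType.

(* finitely supported formal R-linear combinations of elements of X *)
Definition chain (X : Type) := seq (R * X).

Definition coef (X : Type) (c : chain X) (x : X) : R :=
  \sum_(p <- c) (if excluded_middle_informative (p.2 = x) then p.1 else 0).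

Definition ch_eq (X : Type) (c d : chain X) : Prop :=
  forall x, coef c x = coef d x.

Definition ch_map (X Y : Type) (f : X -> Y) (c : chain X) : chain Y :=
  [seq (p.1, f p.2) | p <- c].

Variable G : grp.
(* C_n(G;R) = R[G^n]; d_1 = 0,
   d_2 [g|h] = [h] - [gh] + [g],
   d_3 [g|h|k] = [h|k] - [gh|k] + [g|hk] - [g|h] *)
Definition d2 (c : chain (G * G)) : chain G :=
  flatten [seq let: (r, (g, h)) := p in
             [:: (r, h); (- r, gmul g h); (r, g)] | p <- c].

Definition d3 (c : chain (G * G * G)) : chain (G * G) :=
  flatten [seq let: (r, (g, h, k)) := p in
             [:: (r, (h, k)); (- r, (gmul g h, k)); (r, (g, gmul h k));
                 (- r, (g, h))] | p <- c].

Definition cycle2 (z : chain (G * G)) : Prop := ch_eq (d2 z) [::].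
End Homology.

(* alpha induces an iso on H_1(-;R) and a surjection on H_2(-;R) *)
Definition homology_2connected (R : comPzRingType) (P G : grp) (a : P -> G) :=
  [/\
      (forall c : chain R G, exists (c' : chain R P) (d : chain R (G * G)),
          ch_eq c (ch_map a c' ++ d2 d)),
      (forall c' : chain R P,
          (exists d : chain R (G * G), ch_eq (ch_map a c') (d2 d)) ->
          exists d' : chain R (P * P), ch_eq c' (d2 d')) &
      (forall z : chain R (G * G), cycle2 z ->
          exists (z' : chain R (P * P)) (d : chain R (G * G * G)),
            cycle2 z' /\
            ch_eq z (ch_map (fun x => (a x.1, a x.2)) z' ++ d3 d))].

Definition Omega (R : comPzRingType) (P G : grp) (a : P -> G) : Prop :=
  [/\ fin_presented P, fin_presented G, is_hom a & homology_2connected R a].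

Definition R_local (R : comPzRingType) (K : grp) : Prop :=
  forall (P G : grp) (a : P -> G), Omega R a ->
  forall f : P -> K, is_hom f ->
    exists g : G -> K, [/\ is_hom g, (forall x, g (a x) = f x) &
      forall g' : G -> K, is_hom g' -> (forall x, g' (a x) = f x) ->
        forall y, g' y = g y].

Definition is_group_module (R : comPzRingType) (Gam : grp) (A : lmodType R)
    (act : Gam -> A -> A) : Prop :=
  [/\ forall g a b, act g (a + b) = act g a + act g b,
      forall g (r : R) a, act g (r *: a) = r *: act g a,
      forall a, act (gone Gam) a = a &
      forall g h a, act (gmul g h) a = act g (act h a)].

(* elements of the group ring R[Gamma] as finite formal sums *)
Definition grpring (R : comPzRingType) (Gam : grp) := seq (R * Gam).

Definition gr_act (R : comPzRingType) (Gam : grp) (A : lmodType R)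
    (act : Gam -> A -> A) (x : grpring R Gam) (a : A) : A :=
  \sum_(p <- x) p.1 *: act p.2 a.

Definition augment (R : comPzRingType) (Gam : grp) (x : grpring R Gam) : R :=
  \sum_(p <- x) p.1.

(* A homomorphism F_0 -> F_1 of free R[Gamma]-modules of rank n with bases
   (e_i), (e'_j) is a matrix M with alpha(e_i) = sum_j M i j e'_j.
   f : F_0 -> A, g : F_1 -> A are given by their values on the bases. *)
Definition Cohn_local (R : comPzRingType) (Gam : grp) (A : lmodType R)
    (act : Gam -> A -> A) : Prop :=
  forall (n : nat) (M : 'I_n -> 'I_n -> grpring R Gam),
    (let eM := \matrix_(i < n, j < n) augment (M i j) in
     exists B : 'M[R]_n, B *m eM = 1%:M /\ eM *m B = 1%:M) ->
    forall f : 'I_n -> A,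
      exists g : 'I_n -> A,
        (forall i, f i = \sum_(j < n) gr_act act (M i j) (g j)) /\
        forall g' : 'I_n -> A,
          (forall i, f i = \sum_(j < n) gr_act act (M i j) (g' j)) ->
          forall j, g' j = g j.

Definition is_extension (R : comPzRingType) (Gam : grp) (A : lmodType R)
    (act : Gam -> A -> A) (Gt : grp) (i : A -> Gt) (p : Gt -> Gam) : Prop :=
  (forall a b : A, i (a + b) = gmul (i a) (i b)) /\
  [/\ injective i,
      is_hom p,
      (forall y : Gam, exists t : Gt, p t = y),
      (forall t : Gt, p t = gone Gam <-> exists a, t = i a) &
      (forall (t : Gt) (a : A), i (act (p t) a) = gmul (gmul t (i a)) (ginv t))].

(* Main.v *)
(* Let [a : P -> G] be in Omega^R, [f : P -> Gt], and let [g0 : G -> Gam] extend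
   [p o f]. Present [G] relative to [P] by finitely many generators [y_j] and
   relations [w_k(y) = a(x_k)]. Lifts of [g0] extending [f] are lifts [t_j] of
   [g0(y_j)] with [w_k(t) = f(x_k)]; by Fox calculus, changing [t] by elements
   of [A] turns this into a linear system over [R Gam] whose augmentation is the
   matrix [E] of exponent sums of the [w_k].

   H_1(G, P; R) = 0 gives [S] with [S E = 1]. Then [S] times the Fox matrix
   augments to the identity, so the Cohn property makes the solution unique and
   provides [t] whose defects [u_k], with [w_k(t) = i(u_k) f(x_k)], satisfy
   [S u = 0]. Let [U] be the [R Gam]-span of the [u_k] and [I] the augmentation
   ideal. The [t_j] define a homomorphism [G -> Gt / U] agreeing with [f] on [P],
   hence a relative 2-cocycle on (G, P) with values in [U] whose class modulo [IU]
   has trivial coefficients. As H_2(G, P; R) = 0, every [z] with [z E = 0] has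
   [sum_k z_k u_k] in [IU]. Applied to [z = e_k - e_k E S] this puts every [u_k]
   in [IU], and the Cohn property, as a Nakayama lemma, gives [u = 0]. *)
Require Import Defs.
From Stdlib Require Import ClassicalEpsilon ClassicalDescription IndefiniteDescription.
From Stdlib Require Import ProofIrrelevance PropExtensionality FunctionalExtensionality.
From mathcomp Require Import all_boot all_algebra.
Set Implicit Arguments. Unset Strict Implicit. Unset Printing Implicit Defensive.
Import GRing.Theory.
Local Open Scope ring_scope.

Local Notation "x ** y" := (gmul x y) (at level 40, left associativity).

(** * Groups, words and presentations *)

Section GroupTheory.
Variable G : grp.
Implicit Types x y z : G.

Lemma gmulVr x : x ** ginv x = gone G.
Proof.
rewrite -[LHS]gmul1 -{1}(gmulV (ginv x)) -gmulA [ginv x ** _]gmulA gmulV.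
by rewrite gmul1 gmulV.
Qed.

Lemma gmul1r x : x ** gone G = x.
Proof. by rewrite -(gmulV x) gmulA gmulVr gmul1. Qed.

Lemma gmulK x y : ginv x ** (x ** y) = y.
Proof. by rewrite gmulA gmulV gmul1. Qed.

Lemma gmulVK x y : x ** (ginv x ** y) = y.
Proof. by rewrite gmulA gmulVr gmul1. Qed.

Lemma gmul_injl x y z : x ** y = x ** z -> y = z.
Proof. by move=> e; rewrite -(gmulK x y) e gmulK. Qed.

Lemma gmul_injr x y z : y ** x = z ** x -> y = z.
Proof.
by move=> e; rewrite -(gmul1r y) -(gmulVr x) gmulA e -gmulA gmulVr gmul1r.
Qed.

Lemma ginv_eq x y : x ** y = gone G -> y = ginv x.
Proof. by move=> e; apply: (@gmul_injl x); rewrite e gmulVr. Qed.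

Lemma ginvK x : ginv (ginv x) = x.
Proof. by apply/esym/ginv_eq; rewrite gmulV. Qed.

Lemma ginv1 : ginv (gone G) = gone G.
Proof. by apply/esym/ginv_eq; rewrite gmul1. Qed.

Lemma ginvM x y : ginv (x ** y) = ginv y ** ginv x.
Proof. by apply/esym/ginv_eq; rewrite -gmulA gmulVK gmulVr. Qed.

End GroupTheory.

Lemma hom1 (G H : grp) (f : G -> H) : is_hom f -> f (gone G) = gone H.
Proof.
by move=> hf; apply: (@gmul_injl _ (f (gone G))); rewrite -hf !gmul1r.
Qed.

Lemma homV (G H : grp) (f : G -> H) x : is_hom f -> f (ginv x) = ginv (f x).
Proof. by move=> hf; apply: ginv_eq; rewrite -hf gmulVr hom1. Qed.

Lemma word_eval_cat n (G : grp) (h : 'I_n -> G) w w' :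
  word_eval h (w ++ w') = word_eval h w ** word_eval h w'.
Proof.
by elim: w => [|l w IH] /=; rewrite ?gmul1 // -/(word_eval _ _) IH gmulA.
Qed.

Lemma word_eval_hom n (G H : grp) (f : G -> H) (h : 'I_n -> G) w :
  is_hom f -> f (word_eval h w) = word_eval (fun j => f (h j)) w.
Proof.
move=> hf; elim: w => [|[j b] w IH] /=; first exact: hom1.
by rewrite hf IH; case: b => //=; rewrite homV.
Qed.

Lemma eq_word_eval n (G : grp) (h h' : 'I_n -> G) w :
  h =1 h' -> word_eval h w = word_eval h' w.
Proof. by move=> e; elim: w => //= -[j b] w ->; rewrite e. Qed.

Lemma word_inverse n (w : seq ('I_n * bool)) :
  exists w', forall (G : grp) (h : 'I_n -> G),
    word_eval h w' = ginv (word_eval h w).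
Proof.
elim: w => [|[j b] w [w' IH]]; first by exists [::] => G h; rewrite /= ginv1.
exists (w' ++ [:: (j, ~~ b)]) => G h.
rewrite word_eval_cat IH /= ginvM gmul1r; congr (_ ** _).
by case: b => /=; rewrite ?ginvK.
Qed.

(** * Subgroups and quotients as groups with Leibniz equality *)

Section Subgroup.
Variables (G : grp) (S : G -> Prop).
Hypotheses (S1 : S (gone G)) (SM : forall x y, S x -> S y -> S (x ** y)).
Hypothesis SV : forall x, S x -> S (ginv x).

Let car := {x : G | S x}.

Let car_eq (x y : car) : sval x = sval y -> x = y.
Proof.
case: x y => [x Sx] [y Sy] /= e; rewrite -e in Sy *.
by rewrite (proof_irrelevance _ Sx Sy).
Qed.

Lemma subgroup_exists : exists (K : grp) (v : K -> G),
  [/\ is_hom v, injective v & forall x, S x <-> exists k, v k = x].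
Proof.
pose mul (x y : car) : car := exist _ _ (SM (svalP x) (svalP y)).
pose inv (x : car) : car := exist _ _ (SV (svalP x)).
have A x y z : mul x (mul y z) = mul (mul x y) z by apply/car_eq/gmulA.
have I x : mul (exist _ _ S1) x = x by apply/car_eq/gmul1.
have V x : mul (inv x) x = exist _ _ S1 by apply/car_eq/gmulV.
exists (Grp A I V), sval; split=> // x.
by split=> [Sx|[k <-]]; [exists (exist _ x Sx) | exact: svalP].
Qed.

End Subgroup.

Section Quotient.
Variables (G : grp) (N : G -> Prop).
Hypotheses (N1 : N (gone G)) (NM : forall x y, N x -> N y -> N (x ** y)).
Hypotheses (NV : forall x, N x -> N (ginv x)).
Hypothesis (NJ : forall x y, N y -> N (x ** y ** ginv x)).

Let rel (x y : G) := N (x ** ginv y).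
(** Congruent elements have equal predicates [rel^~ x], so [epsilon] selects the same element for
    both. The fixed points of [repr] are thus one representative per coset. *)
Let repr (x : G) : G := epsilon (inhabits (gone G)) (rel^~ x).

Let relxx x : rel x x. Proof. by rewrite /rel gmulVr. Qed.

Let rel_sym x y : rel x y -> rel y x.
Proof. by move=> /NV; rewrite /rel ginvM ginvK. Qed.

Let rel_trans y x z : rel x y -> rel y z -> rel x z.
Proof. by move=> /NM h /h; rewrite /rel -!gmulA gmulK. Qed.

Let relM x x' y y' : rel x x' -> rel y y' -> rel (x ** y) (x' ** y').
Proof.
move=> hx /(NJ x) hy; have := NM hy hx.
by rewrite /rel ginvM -!gmulA gmulK.
Qed.

Let repr_rel x : rel (repr x) x.
Proof. by apply: (epsilon_spec (inhabits _) (rel^~ x)); exists x. Qed.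

Let repr_eq x y : rel x y -> repr x = repr y.
Proof.
move=> xy; congr epsilon; apply: functional_extensionality => z.
apply: propositional_extensionality; split=> h; first exact: rel_trans h xy.
exact: rel_trans h (rel_sym xy).
Qed.

Let reprK x : repr (repr x) = repr x. Proof. exact: repr_eq. Qed.

Let car := {x : G | repr x = x}.
Let q (x : G) : car := exist _ _ (reprK x).

Let car_eq (x y : car) : sval x = sval y -> x = y.
Proof.
case: x y => [x Sx] [y Sy] /= e; subst y.
by rewrite (proof_irrelevance _ Sx Sy).
Qed.

Let q_eq x y : q x = q y <-> rel x y.
Proof.
split=> [[e]|/repr_eq e]; last exact: car_eq.
by apply: rel_trans (rel_sym (repr_rel x)) _; rewrite e.
Qed.

Let q_sval x : q (sval x) = x. Proof. exact/car_eq/(svalP x). Qed.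

Lemma quotient_exists : exists (Q : grp) (q : G -> Q),
  [/\ is_hom q, forall z, exists x, q x = z &
      forall x y, q x = q y <-> N (x ** ginv y)].
Proof.
pose mul (x y : car) : car := q (sval x ** sval y).
pose inv (x : car) : car := q (ginv (sval x)).
have qM x y : q (x ** y) = mul (q x) (q y).
  by apply/q_eq/rel_sym/relM; apply: repr_rel.
have A x y z : mul x (mul y z) = mul (mul x y) z.
  by rewrite -(q_sval x) -(q_sval y) -(q_sval z) -!qM gmulA.
have I x : mul (q (gone G)) x = x by rewrite -(q_sval x) -!qM gmul1.
have V x : mul (inv x) x = q (gone G).
  by rewrite /inv -{2}(q_sval x) -!qM gmulV.
exists (Grp A I V), q; split=> // z.
by exists (sval z).
Qed.

End Quotient.

(** * Presentations, absolute and relative to a homomorphism *)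

Section Presentation.
Variables (P : grp) (n : nat) (gen : 'I_n -> P) (rels : seq (seq ('I_n * bool))).
Hypothesis presP : presentation gen rels.

Lemma presentation_hom_ext (H : grp) (f g : P -> H) :
  is_hom f -> is_hom g -> (forall j, f (gen j) = g (gen j)) -> f =1 g.
Proof.
move=> hf hg e; case: presP => rel1 /(_ H (fun j => g (gen j))) [r /rel1 r1|].
  by rewrite -word_eval_hom // r1 hom1.
by move=> phi [_ _ u] x; rewrite (u f) // (u g).
Qed.

(** The values of words form a subgroup [K]. The universal property gives a map [P -> K] whose
    composite with the inclusion fixes the generators, hence is the identity. *)
Lemma presentation_generates x : exists w, word_eval gen w = x.
Proof.
have [|||K [v [hv vI vS]]] :=
    @subgroup_exists P (fun x => exists w, word_eval gen w = x).
- by exists [::].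
- by move=> _ _ [w <-] [w' <-]; exists (w ++ w'); rewrite word_eval_cat.
- by move=> _ [w <-]; have [w' e] := word_inverse w; exists w'; rewrite e.
have [j|h vh] := @functional_choice _ _ (fun j k => v k = gen j).
  by apply/vS; exists [:: (j, false)]; rewrite /= gmul1r.
case: (presP) => rel1 /(_ K h) [r /rel1 r1|phi [hphi phigen _]].
  by apply: vI; rewrite word_eval_hom // (eq_word_eval _ vh) r1 hom1.
apply/vS; exists (phi x).
apply: (presentation_hom_ext (f := v \o phi) (g := id)) => // [y z|j] /=.
  by rewrite hphi hv.
by rewrite phigen.
Qed.

End Presentation.

(* [P], new generators [y] and the relations [w k = x k] present [G]: it is the
   pushout of [P] and a free group along the words [w] and the elements [x]. *)
Definition rel_presentation (P G : grp) (a : P -> G) (n : nat) (y : 'I_n -> G)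
    (N : nat) (w : 'I_N -> seq ('I_n * bool)) (x : 'I_N -> P) : Prop :=
  [/\ forall k, word_eval y (w k) = a (x k),
      forall (H : grp) (h : 'I_n -> H) (f : P -> H), is_hom f ->
        (forall k, word_eval h (w k) = f (x k)) ->
        exists g : G -> H, [/\ is_hom g, forall j, g (y j) = h j &
          forall z, g (a z) = f z] &
      forall (H : grp) (f g : G -> H), is_hom f -> is_hom g ->
        (forall j, f (y j) = g (y j)) -> f =1 g].

(** The relations are of two kinds: a word [wa i] spelling the image of each generator [gen i] of
    [P], which forces agreement with [f] on [P], and the relators of [G], paired with the identity
    of [P]. *)
Lemma rel_presentation_exists (P G : grp) (a : P -> G) :
  fin_presented P -> fin_presented G -> is_hom a ->
  exists n (y : 'I_n -> G) N (w : 'I_N -> seq ('I_n * bool)) (x : 'I_N -> P),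
    rel_presentation a y w x.
Proof.
move=> [m [gen [relsP presP]]] [n [y [rels presG]]] ha.
have [wa wa_eval] := functional_choice _
  (fun i => presentation_generates presG (a (gen i))).
pose e (k : 'I_(m + size rels)) := match split k with
  | inl i => (wa i, gen i) | inr l => (tnth (in_tuple rels) l, gone P) end.
exists n, y, (m + size rels)%N, (fun k => (e k).1), (fun k => (e k).2).
have [rel1 univ] := presG.
have eP (T : seq ('I_n * bool) -> P -> Prop) :
    (forall k, T (e k).1 (e k).2) <->
    (forall i, T (wa i) (gen i)) /\ (forall r, r \in rels -> T r (gone P)).
  split=> [Te|[T1 T2] k]; last first.
    by rewrite /e; case: split => [i|l] //=; apply/T2/mem_tnth.
  split=> [i|r /(tnthP (in_tuple rels)) [l ->]].
    by have := Te (unsplit (inl i)); rewrite /e unsplitK.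
  by have := Te (unsplit (inr l)); rewrite /e unsplitK.
split=> [|H h f hf /(eP (fun w x => word_eval h w = f x)) [eqsP eqsG]|].
- by apply/(eP (fun w x => word_eval y w = a x)); split=> // r /rel1 ->; rewrite hom1.
- have [r /eqsG ->|g [hg gy _]] := univ H h; first exact: hom1.
  exists g; split=> //.
  apply: (presentation_hom_ext presP (f := g \o a)) => // [u v|i] /=.
    by rewrite ha hg.
  by rewrite -eqsP -wa_eval word_eval_hom //; apply: eq_word_eval.
- exact: presentation_hom_ext presG.
Qed.

(** * Linear functionals on chains *)

Section Chains.
Variable R : comPzRingType.

Definition ch_scale (X : Type) (r : R) (c : chain R X) : chain R X :=
  [seq (r * e.1, e.2) | e <- c].

Definition ch_sum (I : finType) (X : Type) (c : I -> chain R X) : chain R X :=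
  flatten [seq c k | k <- enum I].

(** Chains are unreduced lists, so identities between them are tested against linear extensions of
    functions. *)
Definition lin (X : Type) (V : lmodType R) (F : X -> V) (c : chain R X) : V :=
  \sum_(e <- c) e.1 *: F e.2.

Section Lin.
Variables (X : Type) (V : lmodType R).
Implicit Types (F : X -> V) (c d : chain R X).

Lemma lin_nil F : lin F [::] = 0.
Proof. exact: big_nil. Qed.

Lemma lin_cons F r x c : lin F ((r, x) :: c) = r *: F x + lin F c.
Proof. exact: big_cons. Qed.

Lemma lin_cat F c d : lin F (c ++ d) = lin F c + lin F d.
Proof. exact: big_cat. Qed.

Lemma lin_scale F r c : lin F (ch_scale r c) = r *: lin F c.
Proof.
by rewrite /lin big_map scaler_sumr; apply: eq_bigr => e _; rewrite scalerA.
Qed.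

Lemma lin_sum (I : finType) F (c : I -> chain R X) :
  lin F (ch_sum c) = \sum_k lin F (c k).
Proof. by rewrite /lin big_flatten big_map big_enum. Qed.

Lemma lin_map (Y : Type) (f : Y -> X) F (b : chain R Y) :
  lin F (ch_map f b) = lin (fun y => F (f y)) b.
Proof. exact: big_map. Qed.

Lemma linD F F' c : lin (fun x => F x + F' x) c = lin F c + lin F' c.
Proof. by rewrite /lin -big_split; apply: eq_bigr => e _; rewrite scalerDr. Qed.

End Lin.

Section ChEq.
Variables (X : Type) (V : lmodType R).
Implicit Types (F : X -> V) (c d : chain R X).

Definition dirac (x y : X) : R^o :=
  if excluded_middle_informative (y = x) then 1 else 0.

Lemma coefE c x : coef c x = lin (dirac x) c.
Proof.
rewrite /coef /lin; apply: eq_bigr => e _; rewrite /dirac.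
case: (excluded_middle_informative (e.2 = x)) => /= _.
  exact: (esym (mulr1 e.1)).
exact: (esym (mulr0 e.1)).
Qed.

(** Induction on the length: the terms at the first point [x] together contribute
    [coef c x *: F x = 0]. Discarding them shortens the list, and the same splitting, applied to
    [dirac], shows that all coefficients stay zero. *)
Lemma lin_ch_eq0 F c : ch_eq c [::] -> lin F c = 0.
Proof.
have [m le_c] := ubnP (size c); elim: m => // m IH in c le_c * => c0.
case: c c0 le_c => [|[r x] c'] c0 le_c; first exact: lin_nil.
set c := _ :: _ in c0 *.
pose E (e : R * X) : bool := excluded_middle_informative (e.2 = x).
have split_lin (W : lmodType R) (F' : X -> W) :
    lin F' c = coef c x *: F' x + lin F' [seq e <- c | ~~ E e].
  rewrite /lin (bigID E) big_filter /=; congr (_ + _).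
  rewrite /coef scaler_suml [LHS]big_mkcond; apply: eq_bigr => e _.
  rewrite /E; case: (excluded_middle_informative (e.2 = x)) => /= [->|_] //.
  by rewrite scale0r.
rewrite split_lin (c0 x) /coef big_nil scale0r add0r; apply: IH.
  rewrite /c /= {1}/E; case: (excluded_middle_informative (x = x)) => //= _.
  by move: le_c; rewrite /= ltnS; apply: leq_ltn_trans; rewrite size_filter count_size.
move=> y; have := c0 y; rewrite coefE split_lin (c0 x) /coef big_nil.
by rewrite scale0r add0r -coefE.
Qed.

Lemma lin_ch_eq F c d : ch_eq c d -> lin F c = lin F d.
Proof.
move=> cd; apply/eqP; rewrite -subr_eq0 -scaleN1r -lin_scale -lin_cat.
apply/eqP/lin_ch_eq0 => x.
rewrite [LHS]coefE lin_cat lin_scale -!coefE cd scaleN1r subrr.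
by rewrite /coef big_nil.
Qed.

End ChEq.

Lemma ch_eqP (X : Type) (c d : chain R X) :
  (forall F : X -> R^o, lin F c = lin F d) -> ch_eq c d.
Proof. by move=> cd x; rewrite !coefE. Qed.

Lemma lin_d2 (G : grp) (V : lmodType R) (F : G -> V) (c : chain R (G * G)) :
  lin F (d2 c) = lin (fun e => F e.2 - F (e.1 ** e.2) + F e.1) c.
Proof.
elim: c => [|[r [g h]] c IH]; first by rewrite !lin_nil.
rewrite -[d2 _]/([:: _; _; _] ++ d2 c) lin_cat IH lin_cons; congr (_ + _).
by rewrite !lin_cons lin_nil /= !scalerDr scalerN scaleNr addr0 addrA.
Qed.

Lemma lin_d3 (G : grp) (V : lmodType R) (F : G * G -> V) (c : chain R (G * G * G)) :
  lin F (d3 c) = lin (fun e => F (e.1.2, e.2) - F (e.1.1 ** e.1.2, e.2)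
                     + F (e.1.1, e.1.2 ** e.2) - F e.1) c.
Proof.
elim: c => [|[r [[g h] k]] c IH]; first by rewrite !lin_nil.
rewrite -[d3 _]/([:: _; _; _; _] ++ d3 c) lin_cat IH lin_cons; congr (_ + _).
rewrite !lin_cons lin_nil /= !scalerDr !scalerN !scaleNr addr0 !addrA //.
Qed.

Definition submodule (V : lmodType R) (S : V -> Prop) : Prop :=
  [/\ S 0, forall a b, S a -> S b -> S (a + b) & forall r a, S a -> S (r *: a)].

Section Submodule.
Variables (V : lmodType R) (S : V -> Prop).
Hypothesis subS : submodule S.

Lemma submod0 : S 0. Proof. by case: subS. Qed.

Lemma submodD a b : S a -> S b -> S (a + b).
Proof. by case: subS => _ + _; apply. Qed.

Lemma submodZ r a : S a -> S (r *: a).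
Proof. by case: subS => _ _; apply. Qed.

Lemma submodN a : S a -> S (- a).
Proof. by move=> Sa; rewrite -scaleN1r; apply: submodZ. Qed.

Lemma submodB a b : S a -> S b -> S (a - b).
Proof. by move=> Sa Sb; apply/submodD/submodN. Qed.

Lemma submod_sum (I : finType) (F : I -> V) :
  (forall k, S (F k)) -> S (\sum_k F k).
Proof. by move=> SF; elim/big_ind: _ => //; [exact: submod0 | exact: submodD]. Qed.

Lemma submod_lin X (F : X -> V) (c : chain R X) :
  (forall x, S (F x)) -> S (lin F c).
Proof.
move=> SF; rewrite /lin; elim/big_ind: _ => //; [exact: submod0|exact: submodD|].
by move=> e _; apply: submodZ.
Qed.

End Submodule.
End Chains.

(** * Exponent sums and Fox derivatives *)

Definition expsum (R : comPzRingType) n (w : seq ('I_n * bool)) (j : 'I_n) : R :=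
  \sum_(l <- w | l.1 == j) (-1) ^+ l.2.

Definition additive_grp (V : zmodType) : grp := Grp (@addrA V) (@add0r V) (@addNr V).

Lemma word_eval_additive (R : comPzRingType) n (V : lmodType R) (h : 'I_n -> V) w :
  word_eval (H := additive_grp V) h w = \sum_j expsum R w j *: h j.
Proof.
elim: w => [|[l b] w IH] /=.
  by rewrite big1 // => j _; rewrite /expsum big_nil scale0r.
transitivity (\sum_j (if l == j then (-1) ^+ b else 0 : R) *: h j
  + \sum_j expsum R w j *: h j).
  rewrite -IH; congr (_ + _).
  rewrite (bigD1 l) //= eqxx big1 ?addr0; last first.
    by move=> j /negPf nj; rewrite eq_sym nj scale0r.
  by case: b; rewrite ?expr1 ?scaleN1r ?expr0 ?scale1r.
rewrite -big_split; apply: eq_bigr => j _ /=.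
rewrite /expsum big_cons -scalerDl; case: eqP => //= _.
by rewrite add0r.
Qed.

(* The cokernel of the matrix of exponent sums is H_1(G, P; R), that is, the
   cokernel of H_1(P; R) -> H_1(G; R). *)
Lemma expsum_left_inverse (R : comPzRingType) (P G : grp) (a : P -> G) n
    (y : 'I_n -> G) N (w : 'I_N -> seq ('I_n * bool)) (x : 'I_N -> P) :
  rel_presentation a y w x ->
  (forall c : chain R G, exists (c' : chain R P) (d : chain R (G * G)),
     ch_eq c (ch_map a c' ++ d2 d)) ->
  exists S : 'I_n -> 'I_N -> R,
    forall j j', \sum_k S j k * expsum R (w k) j' = (j == j')%:R.
Proof.
move=> [wx univ _] H1; pose V : lmodType R := 'rV[R]_n.
pose row k : V := \row_j expsum R (w k) j.
pose span (v : V) := exists z : 'I_N -> R, v = \sum_k z k *: row k.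
have sub_span : submodule span.
  split=> [|_ _ [z ->] [z' ->]|r _ [z ->]].
  - by exists (fun=> 0); rewrite big1 // => k _; rewrite scale0r.
  - exists (fun k => z k + z' k); rewrite -big_split.
    by apply: eq_bigr => k _; rewrite scalerDl.
  - exists (fun k => r * z k); rewrite scaler_sumr.
    by apply: eq_bigr => k _; rewrite scalerA.
suff e_span j : span (delta_mx 0 j).
  have [S eS] := functional_choice _ e_span.
  exists S => j j'; move/(congr1 (fun v : V => v 0 j')): (eS j).
  rewrite mxE summxE eqxx /= eq_sym => ->.
  by apply: eq_bigr => k _; rewrite !mxE.
have [||||Q [q [hq qS qE]]] := @quotient_exists (additive_grp V) span.
- exact: submod0.
- exact: submodD.
- exact: submodN.
- by move=> u v; rewrite /= addrAC subrr add0r.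
have q0 v : q v = gone Q <-> span v.
  by rewrite -(hom1 hq) qE /= subr0.
(* The rows vanish in [Q], so sending [y j] to the class of the [j]-th unit vector and [P] to the
   identity respects the relations. *)
have [|k|phi [hphi phiy phia]] := univ Q (fun j => q (delta_mx 0 j)) (fun=> gone Q).
- by move=> u v; rewrite gmul1.
- rewrite -(word_eval_hom (f := q)) //; apply/q0; rewrite (word_eval_additive (R := R)).
  exists (fun l => (l == k)%:R).
  rewrite [RHS](bigD1 k) //= eqxx scale1r [in RHS]big1 ?addr0.
    by rewrite [RHS]row_sum_delta; apply: eq_bigr => l _; rewrite mxE.
  by move=> l /negPf->; rewrite scale0r.
(* Chains are evaluated in [V] through a set-theoretic lift of [phi]. Modulo [span] it is additive
   and kills the image of [P], so [[y j]], homologous to a chain from [P], has its value in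
   [span]. *)
have [s qs] : exists s : G -> V, forall g, q (s g) = phi g.
  exact: functional_choice (fun g => qS (phi g)).
have s_y : span (delta_mx 0 j - s (y j)).
  by apply/(qE (delta_mx 0 j) (s (y j))); rewrite qs phiy.
have [c' [d]] := H1 [:: (1, y j)].
move/(lin_ch_eq s); rewrite lin_cons lin_nil scale1r addr0 lin_cat lin_map lin_d2.
move=> sy; rewrite -(subrK (s (y j)) (delta_mx 0 j)).
apply: (submodD sub_span s_y); rewrite sy; apply: (submodD sub_span).
  by apply: (submod_lin sub_span) => z; apply/q0; rewrite qs phia.
apply: (submod_lin sub_span) => -[g h] /=.
have : span (s (g ** h) - (s g + s h)).
  by apply/(qE (s (g ** h)) (s g + s h)); rewrite (hq (s g) (s h)) !qs hphi.
by move/(submodN sub_span); rewrite opprB [s g + _]addrC addrAC.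
Qed.

(** * Modules over the group ring *)

Section GroupModule.
Variables (R : comPzRingType) (Gam : grp) (A : lmodType R) (act : Gam -> A -> A).
Hypothesis modA : is_group_module act.
Implicit Types (g : Gam) (x : grpring R Gam) (a b : A).

Lemma actD g a b : act g (a + b) = act g a + act g b.
Proof. by case: modA. Qed.

Lemma actZ g r a : act g (r *: a) = r *: act g a.
Proof. by case: modA. Qed.

Lemma act1 a : act (gone Gam) a = a.
Proof. by case: modA. Qed.

Lemma actM g h a : act (g ** h) a = act g (act h a).
Proof. by case: modA. Qed.

Lemma act0 g : act g 0 = 0.
Proof. by rewrite -{1}(scale0r (0 : A)) actZ scale0r. Qed.

Lemma actN g a : act g (- a) = - act g a.
Proof. by rewrite -scaleN1r actZ scaleN1r. Qed.

Lemma act_sum g (I : finType) (F : I -> A) :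
  act g (\sum_k F k) = \sum_k act g (F k).
Proof. by apply: (big_morph (act g) (actD g) (act0 g)). Qed.

Lemma gr_act_cat x x' a : gr_act act (x ++ x') a = gr_act act x a + gr_act act x' a.
Proof. exact: (lin_cat (act^~ a)). Qed.

Lemma gr_act_scale r x a : gr_act act (ch_scale r x) a = r *: gr_act act x a.
Proof. exact: (lin_scale (act^~ a)). Qed.

Lemma gr_act_chsum (I : finType) (x : I -> grpring R Gam) a :
  gr_act act (ch_sum x) a = \sum_k gr_act act (x k) a.
Proof. exact: (lin_sum (act^~ a)). Qed.

Lemma gr_act_map g x a : gr_act act (ch_map (gmul g) x) a = act g (gr_act act x a).
Proof.
rewrite /gr_act big_map (big_morph (act g) (actD g) (act0 g)).
by apply: eq_bigr => e _; rewrite actM actZ.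
Qed.

Lemma gr_act1 r g a : gr_act act [:: (r, g)] a = r *: act g a.
Proof. by rewrite /gr_act big_seq1. Qed.

Lemma gr_act_nil a : gr_act act [::] a = 0.
Proof. exact: big_nil. Qed.

Lemma gr_act0 x : gr_act act x 0 = 0.
Proof. by rewrite /gr_act big1 // => e _; rewrite act0 scaler0. Qed.

Lemma augment_cat x x' : augment (x ++ x') = augment x + augment x'.
Proof. exact: big_cat. Qed.

Lemma augment_scale r x : augment (ch_scale r x) = r * augment x.
Proof. by rewrite /augment big_map mulr_sumr. Qed.

Lemma augment_chsum (I : finType) (x : I -> grpring R Gam) :
  augment (ch_sum x) = \sum_k augment (x k).
Proof. by rewrite /augment big_flatten big_map big_enum. Qed.

Lemma augment_map g x : augment (ch_map (gmul g) x) = augment x.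
Proof. exact: big_map. Qed.

Lemma augment_nil : @augment R Gam [::] = 0.
Proof. exact: big_nil. Qed.

Lemma augment1 r g : @augment R Gam [:: (r, g)] = r.
Proof. by rewrite /augment big_seq1. Qed.

(* For [e = 0] this says that [a] lies in [I U], where [U] is the submodule
   generated by the [u k] and [I] the augmentation ideal. *)
Definition spanned N (u : 'I_N -> A) (e : 'I_N -> R) (a : A) : Prop :=
  exists x : 'I_N -> grpring R Gam,
    (forall k, augment (x k) = e k) /\ a = \sum_k gr_act act (x k) (u k).

Section Spanned.
Variables (N : nat) (u : 'I_N -> A).

Lemma spannedD e e' a b :
  spanned u e a -> spanned u e' b -> spanned u (fun k => e k + e' k) (a + b).
Proof.
move=> [x [ex ->]] [x' [ex' ->]]; exists (fun k => x k ++ x' k); split=> [k|].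
  by rewrite augment_cat ex ex'.
by rewrite -big_split; apply: eq_bigr => k _; rewrite gr_act_cat.
Qed.

Lemma spannedZ r e a : spanned u e a -> spanned u (fun k => r * e k) (r *: a).
Proof.
move=> [x [ex ->]]; exists (fun k => ch_scale r (x k)); split=> [k|].
  by rewrite augment_scale ex.
by rewrite scaler_sumr; apply: eq_bigr => k _; rewrite gr_act_scale.
Qed.

Lemma spanned_act g e a : spanned u e a -> spanned u e (act g a).
Proof.
move=> [x [ex ->]]; exists (fun k => ch_map (gmul g) (x k)); split=> [k|].
  by rewrite augment_map ex.
by rewrite act_sum; apply: eq_bigr => k _; rewrite gr_act_map.
Qed.

Lemma eq_spanned e e' a : e =1 e' -> spanned u e a -> spanned u e' a.
Proof. by move=> ee' [x [ex ->]]; exists x; split=> // k; rewrite ex ee'. Qed.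

Lemma spanned0 : spanned u (fun=> 0) 0.
Proof.
exists (fun=> [::]); split=> [k|]; first exact: augment_nil.
by rewrite big1 // => k _; rewrite gr_act_nil.
Qed.

Lemma submodule_spanned : submodule (fun a => exists e, spanned u e a).
Proof.
split=> [|a b [e ea] [e' eb]|r a [e ea]].
- by exists (fun=> 0); apply: spanned0.
- by eexists; apply: spannedD ea eb.
- by eexists; apply: spannedZ ea.
Qed.

Lemma submodule_spanned0 : submodule (spanned u (fun=> 0)).
Proof.
split=> [|a b ea eb|r a ea]; first exact: spanned0.
  by apply: eq_spanned (spannedD ea eb) => k; rewrite addr0.
by apply: eq_spanned (spannedZ r ea) => k; rewrite mulr0.
Qed.

Lemma spanned_act_sub g e a : spanned u e a -> spanned u (fun=> 0) (act g a - a).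
Proof.
move=> ea; rewrite -scaleN1r.
apply: eq_spanned (spannedD (spanned_act g ea) (spannedZ (-1) ea)) => k.
by rewrite mulN1r subrr.
Qed.

Lemma spanned_gen k : spanned u (fun l => (k == l)%:R) (u k).
Proof.
exists (fun l => if k == l then [:: (1, gone Gam)] else [::]); split=> [l|].
  by case: eqP => _; rewrite ?augment1 ?augment_nil.
rewrite (bigD1 k) //= eqxx gr_act1 scale1r act1 big1 ?addr0 // => l /negPf nl.
by rewrite eq_sym nl gr_act_nil.
Qed.

End Spanned.

(** * Matrices augmenting to the identity over a Cohn local module *)

Section CohnLocal.
Hypothesis cohnA : Cohn_local act.
Variables (n : nat) (M : 'I_n -> 'I_n -> grpring R Gam).
Hypothesis M1 : forall j l, augment (M j l) = (j == l)%:R.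

Let augM1 : exists B : 'M[R]_n, B *m (\matrix_(j, l) augment (M j l)) = 1%:M /\
  (\matrix_(j, l) augment (M j l)) *m B = 1%:M.
Proof.
exists 1%:M; rewrite mul1mx mulmx1.
by split; apply/matrixP => j l; rewrite !mxE M1.
Qed.

Lemma Cohn_local_solve (f : 'I_n -> A) :
  exists v, forall j, f j = \sum_l gr_act act (M j l) (v l).
Proof. by have [v [vE _]] := cohnA augM1 f; exists v. Qed.

Lemma Cohn_local_inj (v : 'I_n -> A) :
  (forall j, \sum_l gr_act act (M j l) (v l) = 0) -> forall l, v l = 0.
Proof.
move=> v0 l; have [v' [_ uniq]] := cohnA augM1 (fun=> 0).
rewrite (uniq v (fun j => esym (v0 j)) l); apply/esym/(uniq (fun=> 0)) => j.
by rewrite big1 // => k _; rewrite gr_act0.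
Qed.

End CohnLocal.

(** Subtracting from [u k] its expression with coefficients in the augmentation ideal gives a matrix
    that augments to the identity and annihilates [u]. *)
Lemma Cohn_local_Nakayama N (u : 'I_N -> A) : Cohn_local act ->
  (forall k, spanned u (fun=> 0) (u k)) -> forall k, u k = 0.
Proof.
move=> cohnA u0; have u1 k : spanned u (fun l => (k == l)%:R) 0.
  rewrite -[X in spanned _ _ X](subrr (u k)) -scaleN1r.
  apply: eq_spanned (spannedD (spanned_gen u k) (spannedZ (-1) (u0 k))) => l.
  by rewrite mulr0 addr0.
have [M ME] := functional_choice _ u1.
apply: (Cohn_local_inj cohnA (M := M)) => [k l|k]; first by case: (ME k).
by case: (ME k).
Qed.

(** The Fox derivative of [w] in the [j]-th letter, pushed to the group ring along [s]: a product
    [u v] has derivative that of [u] plus [u] times that of [v], and an inverse letter contributes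
    minus itself. *)
Fixpoint fox n (s : 'I_n -> Gam) (w : seq ('I_n * bool)) (j : 'I_n) : grpring R Gam :=
  if w is (l, b) :: w' then
    (if l == j then [:: if b then (-1, ginv (s l)) else (1, gone Gam)] else [::])
    ++ ch_map (gmul (if b then ginv (s l) else s l)) (fox s w' j)
  else [::].

Lemma augment_fox n (s : 'I_n -> Gam) w j : augment (fox s w j) = expsum R w j.
Proof.
elim: w => [|[l b] w IH]; first by rewrite /expsum big_nil augment_nil.
rewrite /= augment_cat augment_map IH /expsum big_cons /=.
case: eqP => _; last by rewrite augment_nil add0r.
by congr (_ + _); case: b; rewrite augment1 ?expr1 ?expr0.
Qed.

(** * Extensions by a module, and Fox calculus in them *)

Section Extension.
Variables (Gt : grp) (i : A -> Gt) (p : Gt -> Gam).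
Hypothesis ext : is_extension act i p.

Lemma extD a b : i (a + b) = i a ** i b. Proof. by case: ext. Qed.
Lemma ext_inj : injective i. Proof. by case: ext => _ []. Qed.
Lemma ext_hom : is_hom p. Proof. by case: ext => _ []. Qed.
Lemma ext_surj g : exists t, p t = g. Proof. by case: ext => _ []. Qed.
Lemma ext_ker t : p t = gone Gam <-> exists a, t = i a.
Proof. by case: ext => _ []. Qed.

Lemma extJ t a : t ** i a = i (act (p t) a) ** t.
Proof.
by case: ext => _ [_ _ _ _ ->]; rewrite -gmulA gmulV gmul1r.
Qed.

Lemma ext0 : i 0 = gone Gt.
Proof. by apply: (@gmul_injl _ (i 0)); rewrite -extD addr0 gmul1r. Qed.

Lemma extN a : i (- a) = ginv (i a).
Proof. by apply: ginv_eq; rewrite -extD subrr ext0. Qed.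

Lemma ext_p a : p (i a) = gone Gam.
Proof. by apply/ext_ker; exists a. Qed.

Lemma ext_fiber t t' : p t = p t' -> exists a, t = i a ** t'.
Proof.
move=> e; have [|a ta] := (ext_ker (t ** ginv t')).1.
  by rewrite ext_hom e -ext_hom gmulVr (hom1 ext_hom).
by exists a; rewrite -ta -gmulA gmulV gmul1r.
Qed.

(** Each factor [i (v l)] is carried to the left through the prefix before it, which acts through
    its image in [Gam]; the total is linear in [v]. *)
Lemma word_eval_fox n (s : 'I_n -> Gam) (t : 'I_n -> Gt) (v : 'I_n -> A) w :
  (forall j, p (t j) = s j) ->
  word_eval (fun j => i (v j) ** t j) w =
  i (\sum_j gr_act act (fox s w j) (v j)) ** word_eval t w.
Proof.
move=> pt; elim: w => [|[l b] w IH].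
  by rewrite big1 => [|j _]; [rewrite ext0 gmul1 | exact: gr_act_nil].
rewrite /= IH; pose tl := if b then ginv (t l) else t l.
pose sl := if b then ginv (s l) else s l.
have ptl : p tl = sl by rewrite /tl /sl; case: (b); rewrite ?(homV _ ext_hom) pt.
pose x j : grpring R Gam :=
  if l == j then [:: if b then (-1, ginv (s l)) else (1, gone Gam)] else [::].
have -> : (if b then ginv (i (v l) ** t l) else i (v l) ** t l)
    = i (\sum_j gr_act act (x j) (v j)) ** tl.
  rewrite (bigD1 l) //= big1 ?addr0 => [|j /negPf nj]; last first.
    by rewrite /x eq_sym nj gr_act_nil.
  rewrite /x /tl eqxx; case: (b); rewrite gr_act1.
    by rewrite scaleN1r extN ginvM -{1}extN extJ (homV _ ext_hom) pt actN extN.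
  by rewrite scale1r act1.
rewrite -/tl -gmulA [tl ** _]gmulA extJ ptl !gmulA -extD act_sum -big_split.
congr (i _ ** _ ** _); apply: eq_bigr => j _.
by rewrite gr_act_cat gr_act_map.
Qed.

End Extension.
End GroupModule.

(** * Cocycles modulo the augmentation ideal *)

Section Cocycle.
Variables (R : comPzRingType) (Gam : grp) (A : lmodType R) (act : Gam -> A -> A).
Variables (Gt : grp) (i : A -> Gt) (p : Gt -> Gam) (G : grp).
Hypotheses (modA : is_group_module act) (ext : is_extension act i p).
Variables (U IU : A -> Prop) (sg : G -> Gt) (c : G * G -> A).
Hypotheses (subU : submodule U) (subIU : submodule IU).
Hypothesis U_act : forall g a, U a -> U (act g a).
Hypothesis IU_act : forall g a, U a -> IU (act g a - a).
Hypothesis sgM : forall g h, sg g ** sg h = i (c (g, h)) ** sg (g ** h).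
Hypothesis Uc : forall e, U (c e).

Lemma sg1 : sg (gone G) = i (c (gone G, gone G)).
Proof. by apply: (@gmul_injr _ (sg (gone G))); rewrite sgM gmul1. Qed.

(** Associativity makes [c] a cocycle twisted by the action of [sg g]. This action is trivial on [U]
    modulo [IU], so there [c] is an untwisted cocycle and vanishes on boundaries. *)
Lemma cocycle_d3 (d : chain R (G * G * G)) : IU (lin c (d3 d)).
Proof.
rewrite lin_d3; apply: (submod_lin subIU) => -[[g h] k] /=.
have e : c (g, h) + c (g ** h, k) = act (p (sg g)) (c (h, k)) + c (g, h ** k).
  apply: (ext_inj ext); apply: (@gmul_injr _ (sg (g ** h ** k))).
  transitivity (sg g ** sg h ** sg k).
    by rewrite (extD ext) -gmulA -sgM gmulA -sgM.
  rewrite -[sg g ** _ ** _]gmulA sgM gmulA (extJ ext) -gmulA sgM.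
  by rewrite (extD ext) -!gmulA.
have -> : c (h, k) - c (g ** h, k) + c (g, h ** k) - c (g, h)
    = - (act (p (sg g)) (c (h, k)) - c (h, k)).
  rewrite opprB -!addrA; congr (_ + _).
  have -> : act (p (sg g)) (c (h, k)) = c (g, h) + c (g ** h, k) - c (g, h ** k).
    by rewrite e addrK.
  by rewrite opprB opprD addrC -addrA.
exact: (submodN subIU (IU_act _ (Uc _))).
Qed.

Variables (n : nat) (y : 'I_n -> G) (tau : 'I_n -> A).

(* Up to [IU], the defect [m] of [s] from [sg g] is the value of the cocycle [c]
   on a chain that bounds [g] by the generators, corrected by their defects. *)
Definition bounded_by (s : Gt) (g : G) (e : 'I_n -> R) : Prop :=
  exists (m : A) (B : chain R (G * G)),
    [/\ U m, s = i m ** sg g,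
        forall F : G -> R^o, lin F (d2 B) = \sum_j e j *: F (y j) - F g &
        IU (lin c B - m + \sum_j e j *: tau j)].

Lemma eq_bounded_by s g e e' : e =1 e' -> bounded_by s g e -> bounded_by s g e'.
Proof.
move=> ee' [m [B [Um sm BF cB]]]; exists m, B; split=> // [F|].
  by rewrite BF; congr (_ - _); apply: eq_bigr => j _; rewrite ee'.
by rewrite -(eq_bigr _ (fun j _ => congr1 ( *:%R^~ _) (ee' j))).
Qed.

Lemma bounded_by1 : bounded_by (gone Gt) (gone G) (fun=> 0).
Proof.
exists (- c (gone G, gone G)), [:: (-1, (gone G, gone G))]; split.
- exact: submodN.
- by rewrite sg1 -(extD ext) addNr (ext0 ext).
- move=> F; rewrite lin_d2 lin_cons lin_nil /= gmul1 subrr add0r addr0 scaleN1r.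
  by rewrite big1 ?sub0r // => j _; rewrite scale0r.
- rewrite lin_cons lin_nil addr0 scaleN1r opprK addNr add0r big1.
    exact: submod0.
  by move=> j _; rewrite scale0r.
Qed.

(** The defect of the product is [m + g m' + c (g, g')], and the cell [(g, g')] has boundary [[g'] -
    [g g'] + [g]]. Replacing [g m'] by [m'] costs an element of [IU]. *)
Lemma bounded_byM s g e s' g' e' : bounded_by s g e -> bounded_by s' g' e' ->
  bounded_by (s ** s') (g ** g') (fun j => e j + e' j).
Proof.
move=> [m [B [Um sm BF cB]]] [m' [B' [Um' sm' BF' cB']]].
pose a := act (p (sg g)) m'.
exists (m + a + c (g, g')), (B ++ B' ++ [:: (1, (g, g'))]); split.
- by do 2?apply: (submodD subU) => //; apply: U_act.
- rewrite sm sm' !(extD ext) -!gmulA -sgM; congr (_ ** _).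
  by rewrite !gmulA -(extJ ext).
- move=> F; rewrite !lin_d2 !lin_cat -!lin_d2 BF BF' lin_d2 lin_cons lin_nil.
  rewrite scale1r addr0 /=; under [in RHS]eq_bigr do rewrite scalerDl.
  by rewrite big_split /= !addrA [LHS](ACl (1*3*6*(2*7)*(4*5)))/= !addNr !addr0.
- under eq_bigr do rewrite scalerDl.
  rewrite big_split /=; set E := \sum_j _ in cB *; set E' := \sum_j _ in cB' *.
  rewrite !lin_cat lin_cons lin_nil scale1r addr0.
  have -> : lin c B + (lin c B' + c (g, g')) - (m + a + c (g, g')) + (E + E')
      = (lin c B - m + E) + (lin c B' - m' + E') - (a - m').
    rewrite opprB [lin c B + _]addrA !opprD !addrA.
    rewrite [LHS](ACl (1*4*7*2*8*5*(3*6)))/= subrr addr0.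
    by rewrite [RHS](ACl (1*2*3*4*6*8*(5*7)))/= addNr addr0.
  apply: (submodB subIU); last exact: IU_act.
  exact: (submodD subIU).
Qed.

Lemma bounded_byV s g e : bounded_by s g e ->
  bounded_by (ginv s) (ginv g) (fun j => - e j).
Proof.
move=> [m [B [Um sm BF cB]]]; pose o := gone G.
(* The defect [m'] is forced: [s ** (i m' ** sg (ginv g))] equals [i (b + g m')], because [sg o] is
   [i (c (o, o))], and must be trivial. *)
pose b := m + c (g, ginv g) + c (o, o).
have Ub : U b by do 2?apply: (submodD subU).
pose m' := - act (ginv (p (sg g))) b.
have bE : act (p (sg g)) m' = - b.
  by rewrite /m' (actN modA) -(actM modA) gmulVr (act1 modA).
have Um' : U m' by apply/(submodN subU)/U_act.
exists m', (ch_scale (-1) B ++ [:: (-1, (g, ginv g)); (-1, (o, o))]); split=> //.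
- apply/esym/ginv_eq; rewrite sm -gmulA [sg g ** _]gmulA (extJ ext) -gmulA sgM.
  rewrite gmulVr sg1 -!(extD ext) bE -(ext0 ext); congr i.
  by rewrite addrCA [m + _]addrA addNr.
- move=> F; rewrite lin_d2 lin_cat lin_scale -lin_d2 BF !lin_cons lin_nil /=.
  rewrite gmulVr gmul1 subrr add0r addr0 !scaleN1r.
  under [in RHS]eq_bigr do rewrite scaleNr.
  rewrite sumrN !opprD !opprK !addrA.
  by rewrite [LHS](ACl (1*3*(2*5)*(4*6)))/= !subrr !addr0.
- under eq_bigr do rewrite scaleNr.
  rewrite sumrN; set E := \sum_j _ in cB *.
  rewrite lin_cat lin_scale !lin_cons lin_nil addr0 !scaleN1r.
  have -> : - lin c B + (- c (g, ginv g) - c (o, o)) - m' - E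
      = - (lin c B - m + E) + (- b - m').
    rewrite /b !opprD !opprK !addrA.
    by rewrite [RHS](ACl (1*5*6*7*3*(2*4)))/= subrr addr0.
  apply: (submodD subIU); first exact: (submodN subIU).
  by rewrite -bE; apply: IU_act.
Qed.

Lemma bounded_by_gen (t : 'I_n -> Gt) j : U (tau j) -> t j = i (tau j) ** sg (y j) ->
  bounded_by (t j) (y j) (fun l => (l == j)%:R).
Proof.
move=> Utau tj; exists (tau j), [::].
have sum_delta (V : lmodType R) (F : 'I_n -> V) : \sum_l (l == j)%:R *: F l = F j.
  rewrite (bigD1 j) //= eqxx scale1r big1 ?addr0 // => l /negPf->.
  exact: scale0r.
split=> // [F|]; rewrite sum_delta ?subrr lin_nil //.
by rewrite sub0r addNr; apply: submod0.
Qed.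

Lemma bounded_by_word (t : 'I_n -> Gt) w :
  (forall j, U (tau j)) -> (forall j, t j = i (tau j) ** sg (y j)) ->
  bounded_by (word_eval t w) (word_eval y w) (expsum R w).
Proof.
move=> Utau tE; elim: w => [|[l b] w IH] /=.
  by apply: eq_bounded_by bounded_by1 => j; rewrite /expsum big_nil.
have bl : bounded_by (if b then ginv (t l) else t l)
    (if b then ginv (y l) else y l) (fun j => if j == l then (-1) ^+ b else 0).
  have := bounded_by_gen (Utau l) (tE l); case: (b) => [/bounded_byV|];
  by apply: eq_bounded_by => j; case: eqP; rewrite ?oppr0.
apply: eq_bounded_by (bounded_byM bl IH) => j.
by rewrite /expsum big_cons /= [l == j]eq_sym; case: eqP; rewrite ?add0r.
Qed.

End Cocycle.

(** * Lifting homomorphisms through the extension *)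

Section Lifting.
Variables (R : comPzRingType) (Gam : grp) (A : lmodType R) (act : Gam -> A -> A).
Variables (Gt : grp) (i : A -> Gt) (p : Gt -> Gam).
Hypotheses (modA : is_group_module act) (ext : is_extension act i p).
Variables (P G : grp) (a : P -> G) (n : nat) (y : 'I_n -> G).
Variables (N : nat) (w : 'I_N -> seq ('I_n * bool)) (x : 'I_N -> P).
Hypotheses (ha : is_hom a) (presG : rel_presentation a y w x).
Hypothesis (conn : homology_2connected R a).

(** The weights [z] cancel the exponents of all generators, so the relations combine to a relative
    2-cycle of [(G, P)]. The homology hypotheses move it into [P], where the defect cocycle is a
    coboundary modulo [IU]. *)
Lemma spanned_relation (f : P -> Gt) (t : 'I_n -> Gt) (u : 'I_N -> A) (z : 'I_N -> R) :
  is_hom f -> (forall k, word_eval t (w k) = i (u k) ** f (x k)) ->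
  (forall j, \sum_k z k * expsum R (w k) j = 0) ->
  spanned act u (fun=> 0) (\sum_k z k *: u k).
Proof.
move=> hf tw z0; have [wx univ _] := presG; have [_ H1inj H2] := conn.
pose U b := exists e, spanned act u e b; pose IU := spanned act u (fun=> 0).
have subU : submodule U by apply: submodule_spanned.
have subIU : submodule IU by apply: submodule_spanned0.
have U_act g b : U b -> U (act g b) by move=> [e eb]; exists e; apply: spanned_act.
have IU_act g b : U b -> IU (act g b - b) by move=> [e eb]; apply: spanned_act_sub eb.
have [||||Q [q [hq qS qE]]] := @quotient_exists Gt (fun s => exists b, U b /\ s = i b).
- by exists 0; rewrite (ext0 ext); split=> //; apply: submod0.
- move=> _ _ [b [Ub ->]] [b' [Ub' ->]]; exists (b + b'); rewrite (extD ext).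
  by split=> //; apply: submodD.
- by move=> _ [b [Ub ->]]; exists (- b); rewrite (extN ext); split=> //; apply: submodN.
- move=> s _ [b [Ub ->]]; exists (act (p s) b); rewrite (extJ ext).
  by rewrite -gmulA gmulVr gmul1r; split=> //; apply: U_act.
have qE' s s' : q s = q s' -> exists b, U b /\ s = i b ** s'.
  by move/qE => [b [Ub e]]; exists b; rewrite -e -gmulA gmulV gmul1r.
have qi b : U b -> q (i b) = gone Q.
  by move=> Ub; rewrite -(hom1 hq); apply/qE; exists b; rewrite ginv1 gmul1r.
have [|k|phi [hphi phiy phia]] := univ Q (fun j => q (t j)) (fun v => q (f v)).
- by move=> v v'; rewrite hf hq.
- rewrite -word_eval_hom // tw hq qi ?gmul1 //.
  by exists (fun l => (k == l)%:R); apply: spanned_gen.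
(* [sg] lifts [phi] only as a function. Three defects in [U] are recorded: [c] for multiplicativity,
   [de] against [f] on [P], [tau] against [t] on the generators. *)
have [sg qsg] := functional_choice _ (fun g => qS (phi g)).
have [|c cP] := @functional_choice _ _ (fun (e : G * G) b =>
    U b /\ sg e.1 ** sg e.2 = i b ** sg (e.1 ** e.2)).
  by move=> [g h]; apply: qE'; rewrite hq !qsg hphi.
have [|de deP] := @functional_choice _ _ (fun v b => U b /\ f v = i b ** sg (a v)).
  by move=> v; apply: qE'; rewrite qsg phia.
have [|tau tauP] := @functional_choice _ _ (fun j b => U b /\ t j = i b ** sg (y j)).
  by move=> j; apply: qE'; rewrite qsg phiy.
have sgM g h : sg g ** sg h = i (c (g, h)) ** sg (g ** h) by case: (cP (g, h)).
have Uc e : U (c e) by case: (cP e).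
have [|B BP] := @functional_choice _ _ (fun k B =>
    (forall F : G -> R^o,
       lin F (d2 B) = \sum_j expsum R (w k) j *: F (y j) - F (a (x k))) /\
    IU (lin c B - (u k + de (x k)) + \sum_j expsum R (w k) j *: tau j)).
  move=> k.
  have [j|j|m [B [Um e BF cB]]] := @bounded_by_word _ _ _ _ _ _ _ _ modA ext _ _ _ _
    subU subIU U_act IU_act sgM Uc _ y tau t (w k); try by case: (tauP j).
  exists B; rewrite -wx; split=> //; suff <- : m = u k + de (x k) by [].
  apply: (ext_inj ext); apply: (@gmul_injr _ (sg (word_eval y (w k)))).
  by rewrite -e tw (extD ext) -gmulA; case: (deP (x k)) => _ ->; rewrite wx.
pose aa (e : P * P) := (a e.1, a e.2).
(* As [f] is a homomorphism, [c] on [P] is minus the coboundary of [de], up to the action on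
   [de v'], an error in [IU]. *)
have cde d : IU (lin c (ch_map aa d) + lin de (d2 d)).
  rewrite lin_map lin_d2 -linD; apply: (submod_lin subIU) => -[v v'] /=.
  have -> : c (aa (v, v')) = de (v ** v') - (de v + act (p (sg (a v))) (de v')).
    apply/eqP; rewrite eq_sym subr_eq; apply/eqP.
    apply: (ext_inj ext); apply: (@gmul_injr _ (sg (a v ** a v'))).
    rewrite -ha; case: (deP (v ** v')) => _ <-; rewrite hf ha.
    case: (deP v) (deP v') => _ -> [_ ->].
    rewrite addrC !(extD ext) -!gmulA -sgM; congr (_ ** _).
    by rewrite !gmulA (extJ ext).
  have : IU (- (act (p (sg (a v))) (de v') - de v')).
    by apply/(submodN subIU)/IU_act; case: (deP v').
  rewrite opprB opprD !addrA; set e := act _ _.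
  by rewrite [X in _ -> IU X](ACl ((1*5)*(2*6)*4*3))/= subrr addNr !add0r.
have zE (V : lmodType R) (F : 'I_n -> V) :
    \sum_k z k *: (\sum_j expsum R (w k) j *: F j) = 0.
  under eq_bigr do rewrite scaler_sumr.
  rewrite exchange_big big1 // => j _.
  under eq_bigr do rewrite scalerA.
  by rewrite -scaler_suml z0 scale0r.
have d2_map (F : G -> R^o) d : lin F (d2 (ch_map aa d)) = lin (fun v => F (a v)) (d2 d).
  by rewrite !lin_d2 lin_map; apply: eq_bigr => e _; rewrite /= ha.
pose zB := ch_sum (fun k => ch_scale (z k) (B k)).
pose zx := ch_sum (fun k => [:: (z k, x k)]).
have zxE (V : lmodType R) (F : P -> V) : lin F zx = \sum_k z k *: F (x k).
  by rewrite lin_sum; apply: eq_bigr => k _; rewrite lin_cons lin_nil addr0.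
have zBF (F : G -> R^o) : lin F (d2 zB) = - \sum_k z k *: F (a (x k)).
  transitivity (\sum_k z k *: (\sum_j expsum R (w k) j *: F (y j))
    - \sum_k z k *: F (a (x k))); last by rewrite zE add0r.
  rewrite lin_d2 lin_sum -sumrB; apply: eq_bigr => k _.
  by rewrite lin_scale -lin_d2; case: (BP k) => -> _; rewrite scalerBr.
(* The image of [zx] is the boundary of [- zB], so injectivity on [H_1] makes [zx] bound in [P];
   adding the image of [d'] then closes [zB] to a cycle. *)
have [d' d'E] : exists d', ch_eq zx (d2 d').
  apply: H1inj; exists (ch_scale (-1) zB); apply: ch_eqP => F.
  by rewrite lin_map zxE lin_d2 lin_scale -lin_d2 zBF scaleN1r opprK.
have [|z' [d [z'0 zE']]] := H2 (zB ++ ch_map aa d').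
  apply: ch_eqP => F; rewrite lin_nil lin_d2 lin_cat -!lin_d2 zBF d2_map.
  by rewrite -(lin_ch_eq _ d'E) zxE addNr.
have := lin_ch_eq c zE'; rewrite !lin_cat => eqc.
have dez' : lin de (d2 z') = 0 by rewrite (lin_ch_eq _ z'0) lin_nil.
have ded' : lin de (d2 d') = \sum_k z k *: de (x k) by rewrite -(lin_ch_eq _ d'E) zxE.
have cz' := cde z'; rewrite dez' addr0 in cz'.
have cd' := cde d'; rewrite ded' in cd'.
have czB : IU (lin c zB - \sum_k z k *: u k - \sum_k z k *: de (x k)).
  have := submod_sum subIU (fun k => submodZ subIU (z k) (BP k).2).
  under eq_bigr do rewrite scalerDr scalerBr scalerDr opprD addrA.
  rewrite big_split /= zE addr0 !big_split /= !sumrN lin_sum.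
  by under [X in _ -> IU (X - _ - _)]eq_bigr do rewrite lin_scale.
(* Evaluating [c] on both sides of [zE'] isolates the sum; each of the three brackets lies in
   [IU]. *)
have -> : \sum_k z k *: u k = (lin c (ch_map aa z') + lin c (d3 d))
   - (lin c (ch_map aa d') + \sum_k z k *: de (x k))
   - (lin c zB - \sum_k z k *: u k - \sum_k z k *: de (x k)).
  rewrite -eqc !opprD !opprK !addrA.
  by rewrite [RHS](ACl (6*(1*5)*(2*3)*(4*7)))/= !subrr addNr !addr0.
apply: (submodB subIU) => //; apply: (submodB subIU) => //.
apply: (submodD subIU) => //; exact: (cocycle_d3 ext subIU IU_act sgM Uc).
Qed.



Hypothesis cohnA : Cohn_local act.
Variables (g0 : G -> Gam) (f : P -> Gt).
Hypotheses (hf : is_hom f) (hg0 : is_hom g0) (g0a : forall v, g0 (a v) = p (f v)).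

Let s j := g0 (y j).

(** Two solutions differ by a vector [v] killed by the Fox matrix, hence by its product [M] with
    [S], which augments to [S E = 1]. *)
Lemma lift_relations_unique (t t' : 'I_n -> Gt) :
  (forall j, p (t j) = s j) -> (forall j, p (t' j) = s j) ->
  (forall k, word_eval t (w k) = f (x k)) ->
  (forall k, word_eval t' (w k) = f (x k)) -> t =1 t'.
Proof.
move=> pt pt' tw tw'; have [H1 _ _] := conn.
have [S SE] := expsum_left_inverse presG H1.
have [|v vE] := @functional_choice _ _ (fun j b => t j = i b ** t' j).
  by move=> j; apply: (ext_fiber ext); rewrite pt pt'.
pose M j l := ch_sum (fun k => ch_scale (S j k) (fox R s (w k) l)).
suff v0 : forall j, v j = 0 by move=> j; rewrite vE v0 (ext0 ext) gmul1.
apply: (Cohn_local_inj modA cohnA (M := M)) => [j l|j].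
  rewrite augment_chsum -SE; apply: eq_bigr => k _.
  by rewrite augment_scale augment_fox.
under eq_bigr do rewrite gr_act_chsum.
rewrite exchange_big big1 // => k _.
under eq_bigr do rewrite gr_act_scale.
rewrite -scaler_sumr; suff -> : \sum_l gr_act act (fox R s (w k) l) (v l) = 0.
  exact: scaler0.
apply: (ext_inj ext); apply: (@gmul_injr _ (word_eval t' (w k))).
rewrite -(word_eval_fox modA ext) // (ext0 ext) gmul1 tw' -tw.
by apply: eq_word_eval => l; rewrite vE.
Qed.

Lemma lift_relations_exist : exists t : 'I_n -> Gt,
  (forall j, p (t j) = s j) /\ (forall k, word_eval t (w k) = f (x k)).
Proof.
have [H1 _ _] := conn; have [wx _ _] := presG.
have [S SE] := expsum_left_inverse presG H1.
have [t0 pt0] := functional_choice _ (fun j => ext_surj ext (s j)).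
have [|u0 u0E] := @functional_choice _ _
    (fun k b => word_eval t0 (w k) = i b ** f (x k)).
  move=> k; apply: (ext_fiber ext); rewrite -g0a -wx (word_eval_hom _ _ (ext_hom ext)).
  by rewrite (word_eval_hom _ _ hg0); apply: eq_word_eval.
pose D k l := fox R s (w k) l.
pose M j l := ch_sum (fun k => ch_scale (S j k) (D k l)).
(* The Fox matrix need not be square, so only [M v = - S u0] is solved; for the corrected lifts this
   says [S u = 0]. *)
have [|v vE] := Cohn_local_solve cohnA (M := M) _ (fun j => - \sum_k S j k *: u0 k).
  move=> j l; rewrite augment_chsum -SE; apply: eq_bigr => k _.
  by rewrite augment_scale augment_fox.
pose t j := i (v j) ** t0 j; pose u k := \sum_l gr_act act (D k l) (v l) + u0 k.
have pt j : p (t j) = s j by rewrite (ext_hom ext) (ext_p ext) gmul1.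
have tw k : word_eval t (w k) = i (u k) ** f (x k).
  by rewrite (word_eval_fox modA ext _ _ pt0) u0E (extD ext) gmulA.
have Su j : \sum_k S j k *: u k = 0.
  rewrite /u; under eq_bigr do rewrite scalerDr scaler_sumr.
  rewrite big_split /= exchange_big /=; apply/eqP; rewrite addr_eq0 vE; apply/eqP.
  apply: eq_bigr => l _; rewrite gr_act_chsum; apply: eq_bigr => k _.
  by rewrite gr_act_scale.
exists t; split=> // k; suff u0' : u k = 0 by rewrite tw u0' (ext0 ext) gmul1.
move: k; apply: (Cohn_local_Nakayama modA cohnA) => k.
(* The [k]-th row of [1 - E S]: [z E = 0] since [S E = 1], and [z u = u k] since [S u = 0]. *)
pose z l := (k == l)%:R - \sum_j expsum R (w k) j * S j l.
have -> : u k = \sum_l z l *: u l.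
  under eq_bigr do rewrite scalerBl scaler_suml.
  rewrite sumrB exchange_big /= [X in _ - X]big1 => [|j _]; last first.
    under eq_bigr do rewrite -scalerA.
    by rewrite -scaler_sumr Su scaler0.
  rewrite subr0 (bigD1 k) //= eqxx scale1r big1 ?addr0 // => l /negPf nl.
  by rewrite eq_sym nl scale0r.
apply: (spanned_relation hf tw) => j.
under eq_bigr do rewrite mulrBl mulr_suml.
rewrite sumrB exchange_big /= (bigD1 k) //= eqxx mul1r [X in _ + X - _]big1 ?addr0.
  rewrite (bigD1 j) //= [X in _ - (_ + X)]big1 => [|l /negPf nl].
    under eq_bigr do rewrite -mulrA.
    by rewrite -mulr_sumr SE eqxx mulr1 addr0 subrr.
  under eq_bigr do rewrite -mulrA.
  by rewrite -mulr_sumr SE nl mulr0.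
by move=> l /negPf nl; rewrite eq_sym nl mul0r.
Qed.

End Lifting.

(** * Locality of the extension group *)

Theorem theoremA2 (R : comPzRingType) (Gam : grp) (A : lmodType R)
    (act : Gam -> A -> A) (Gt : grp) (i : A -> Gt) (p : Gt -> Gam) :
  R_local R Gam ->
  is_group_module act ->
  Cohn_local act ->
  is_extension act i p ->
  R_local R Gt.
Proof.
move=> locGam modA cohnA ext P G a aOm f hf.
have [fpP fpG ha conn] := aOm.
have [n [y [N [w [x presG]]]]] := rel_presentation_exists fpP fpG ha.
have [wx univ extG] := presG; have hp := ext_hom ext.
have [|g0 [hg0 g0a g0u]] := locGam P G a aOm (fun v => p (f v)).
  by move=> v v'; rewrite hf hp.
have [t [pt tw]] := lift_relations_exist modA ext ha presG conn cohnA hf hg0 g0a.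
have [g [hg gy ga]] := univ Gt t f hf tw.
exists g; split=> // g' hg' g'a; apply: extG => // j; rewrite gy.
apply: (lift_relations_unique modA ext presG conn cohnA (g0 := g0) (f := f)
  (t := fun j => g' (y j))) => // {}j.
(* Both [p o g'] and [g0] extend [p o f], so uniqueness for the local group [Gam] identifies
   them. *)
- by apply: (g0u (fun b => p (g' b))) => [b b'|v]; rewrite ?hg' ?hp ?g'a.
- by rewrite -word_eval_hom // wx.
Qed.
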